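(* The following two statements are equivalent: (a) for every almost ideal access structure $\mathcal{A}$, the dual access structure $\mathcal{A}^\perp$ is almost ideal; (b) for every almost entropic matroid $\mathcal M$, the dual $\mathcal M^\perp$ is almost entropic.
   Context: A polymatroid $(f,M)$ consists of a finite set $M$ and a function $f$ on subsets of $M$ with $f(\emptyset)=0$ that is non-negative, monotone and submodular. It is entropic if there are jointly distributed discrete random variables $\langle\xi_i:i\in M\rangle$ with $f(A)=\mathbf H(\xi_A)$ for all $A\subseteq M$; almost entropic if, as a vector in $\mathbb R^{2^{|M|}-1}$, it lies in the closure of the entropic polymatroids on $M$. A matroid is an integer-valued polymatroid in which every singleton has rank $0$ or $1$; it is almost entropic if it is almost entropic as a polymatroid. The dual of $(f,M)$ is $(f^\perp,M)$ with $f^\perp(A)=f(M\setminus A)+\sum_{i\in A}f(i)-f(M)$. An access structure on a finite set $P$ is a non-empty upward-closed $\mathcal{A}\subseteq 2^P$ with $\emptyset\notin\mathcal{A}$; its dual is $\mathcal{A}^\perp=\{A\subseteq P: P\setminus A\notin\mathcal{A}\}$. Let $s\notin P$; juxtaposition denotes union. A polymatroid $(f,sP)$ realizes $\mathcal{A}$ if for every $A\subseteq P$: $A\in\mathcal{A}$ iff $f(sA)=f(A)$, and $A\notin\mathcal{A}$ iff $f(sA)=f(A)+f(s)$. Its complexity is $\max_{i\in P}f(i)/f(s)$. $\mathcal{A}$ is almost ideal if it is realized by some almost entropic polymatroid of complexity $1$. *)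

(* Defs.v *)
From HB Require Import structures.
From mathcomp Require Import all_boot.
From Stdlib Require Import Reals.

Set Implicit Arguments.
Unset Strict Implicit.
Unset Printing Implicit Defensive.

Local Open Scope R_scope.

Definition is_polymatroid (M : finType) (f : {set M} -> R) : Prop :=
  f set0 = 0 /\
  (forall A, 0 <= f A) /\
  (forall A B : {set M}, A \subset B -> f A <= f B) /\
  (forall A B : {set M}, f (A :|: B) + f (A :&: B) <= f A + f B).

(** Joint distributions of finitely-valued random variables: a finite sample
    space 'I_n with probability weights p, and random variables xi i : 'I_n -> nat. *)
Definition joint (M : finType) (n : nat) (xi : M -> 'I_n -> nat) (A : {set M})
  (w : 'I_n) : seq nat := [seq xi i w | i <- enum A].

Definition prob (n : nat) (p : 'I_n -> R) (X : 'I_n -> seq nat) (v : seq nat) : R :=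
  \big[Rplus/0]_(w < n | X w == v) p w.

Definition entropy (n : nat) (p : 'I_n -> R) (X : 'I_n -> seq nat) : R :=
  \big[Rplus/0]_(v <- undup [seq X w | w <- enum 'I_n])
     (- (prob p X v * ln (prob p X v))).

Definition is_entropic (M : finType) (f : {set M} -> R) : Prop :=
  exists (n : nat) (p : 'I_n -> R) (xi : M -> 'I_n -> nat),
    (forall w, 0 <= p w) /\
    \big[Rplus/0]_(w < n) p w = 1 /\
    (forall A : {set M}, f A = entropy p (joint xi A)).

Definition is_almost_entropic (M : finType) (f : {set M} -> R) : Prop :=
  forall eps, 0 < eps ->
    exists g : {set M} -> R, is_entropic g /\
      (forall A : {set M}, Rabs (f A - g A) < eps).

Definition is_matroid (M : finType) (f : {set M} -> R) : Prop :=
  is_polymatroid f /\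
  (forall A : {set M}, exists z : Z, f A = IZR z) /\
  (forall i : M, f [set i] = 0 \/ f [set i] = 1).

Definition poly_dual (M : finType) (f : {set M} -> R) (A : {set M}) : R :=
  f (~: A) + \big[Rplus/0]_(i in A) f [set i] - f setT.

Definition is_access_structure (P : finType) (Acc : {set {set P}}) : Prop :=
  Acc <> set0 /\
  (forall A B : {set P}, A \in Acc -> A \subset B -> B \in Acc) /\
  ~ (set0 \in Acc).

Definition dual_access (P : finType) (Acc : {set {set P}}) : {set {set P}} :=
  [set A : {set P} | ~: A \notin Acc].

(** Ground set sP is option P, with s = None. *)
Definition sAdd (P : finType) (A : {set P}) : {set option P} :=
  (@None P) |: (Some @: A).

Definition realizes (P : finType) (f : {set option P} -> R) (Acc : {set {set P}}) : Prop :=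
  forall A : {set P},
    (A \in Acc <-> f (sAdd A) = f (Some @: A)) /\
    (A \notin Acc <-> f (sAdd A) = f (Some @: A) + f [set (@None P)]).

Definition complexity_one (P : finType) (f : {set option P} -> R) : Prop :=
  (forall i : P, f [set Some i] / f [set (@None P)] <= 1) /\
  (exists i : P, f [set Some i] / f [set (@None P)] = 1).

Definition almost_ideal (P : finType) (Acc : {set {set P}}) : Prop :=
  exists f : {set option P} -> R,
    is_polymatroid f /\ is_almost_entropic f /\ realizes f Acc /\ complexity_one f.

(* Main.v *)
(** Along a matroid port the secret has rank 1, and the rank of the nondummy
    participants turns out to be an integer that can be read off the access
    structure: a circuit [C] avoiding the secret is detected by a shortest "ear"
    [X] joining the secret to some element of [C].  Hence a realization of
    complexity 1 is, up to scaling and on the nondummies, a matroid determined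
    by its access structure.  As the almost entropic polymatroids form a cone
    closed under restriction, duality of matroids passes to access structures.
    Conversely, let [s] be an element of a matroid whose dual rank is not zero.
    The dual of the port at [s] is realized by an almost entropic polymatroid,
    which by uniqueness is the dual matroid on [s] and the nondummies.  The same
    uniqueness, applied to the contraction of the dummies, shows that this set
    is a separator, so one can split it off and induct. *)

Require Import Defs.
From HB Require Import structures.
From mathcomp Require Import all_boot.
From Stdlib Require Import Reals Lra Lia.

Set Implicit Arguments.
Unset Strict Implicit.
Unset Printing Implicit Defensive.
Local Open Scope R_scope.

(** * Sums of real numbers as big operators *)

HB.instance Definition _ := Monoid.isComLaw.Build R 0 Rplus
  (fun x y z => esym (Rplus_assoc x y z)) Rplus_comm Rplus_0_l.
HB.instance Definition _ := Monoid.isMulLaw.Build R 0 Rmult Rmult_0_l Rmult_0_r.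
HB.instance Definition _ := Monoid.isAddLaw.Build R Rmult Rplus
  Rmult_plus_distr_r Rmult_plus_distr_l.

Lemma Rsum_ge0 (I : finType) (P : pred I) (F : I -> R) :
  (forall i, P i -> 0 <= F i) -> 0 <= \big[Rplus/0]_(i | P i) F i.
Proof.
move=> F0; apply: (big_ind (fun x => 0 <= x)) => //; first lra.
by move=> x y; lra.
Qed.

Lemma Rsum_ge_term (I : finType) (P : pred I) (F : I -> R) (j : I) :
  (forall i, 0 <= F i) -> P j -> F j <= \big[Rplus/0]_(i | P i) F i.
Proof.
move=> F0 Pj; rewrite (bigD1 j) //=.
by have := @Rsum_ge0 _ (fun i => P i && (i != j)) F (fun i _ => F0 i); lra.
Qed.

Lemma Rsum_opp (I : Type) (r : seq I) (P : pred I) (F : I -> R) :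
  \big[Rplus/0]_(i <- r | P i) (- F i) = - \big[Rplus/0]_(i <- r | P i) F i.
Proof. by apply/esym; apply: (big_morph Ropp) => [x y|]; lra. Qed.

Lemma Rsum_option (W : finType) (F : option W -> R) :
  \big[Rplus/0]_w F w = F None + \big[Rplus/0]_w F (Some w).
Proof.
rewrite (bigD1 None) //=; congr (_ + _).
rewrite (@reindex_omap _ _ _ _ _ Some (fun w => w)) => [|[]] //=.
by apply: eq_bigl => w; rewrite eqxx.
Qed.

(** * Entropy through kernels *)

(* The entropy of a random variable depends only on the equivalence relation
   [e] on the sample space whose classes are its level sets. *)
Definition kentropy (W : finType) (p : W -> R) (e : rel W) : R :=
  \big[Rplus/0]_w (- (p w * ln (\big[Rplus/0]_(w' | e w w') p w'))).

Definition agree (M W : finType) (T : eqType) (xi : M -> W -> T) (A : {set M})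
    (w w' : W) : bool :=
  [forall i in A, xi i w == xi i w'].

Lemma eq_kentropy (W : finType) (p : W -> R) (e e' : rel W) :
  e =2 e' -> kentropy p e = kentropy p e'.
Proof.
move=> ee; apply: eq_bigr => w _; congr (- (_ * ln _)).
exact: eq_bigl => w'; rewrite ee.
Qed.

Lemma agreeP (M W : finType) (T : eqType) (xi : M -> W -> T) (A : {set M}) w w' :
  reflect (forall i, i \in A -> xi i w = xi i w') (agree xi A w w').
Proof. exact: 'forall_in_eqP. Qed.

Lemma joint_eqE (M : finType) n (xi : M -> 'I_n -> nat) A w w' :
  (joint xi A w == joint xi A w') = agree xi A w w'.
Proof.
apply/eqP/agreeP => [/eq_in_map E i iA | E].
  by apply: E; rewrite mem_enum.
by apply/eq_in_map => i; rewrite mem_enum; apply: E.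
Qed.

(** Every sample point [w] feeds exactly one value, [X w], so the sum over values regroups into a
    sum over sample points. *)
Lemma entropyE n (p : 'I_n -> R) (X : 'I_n -> seq nat) :
  entropy p X = kentropy p (fun w w' => X w == X w').
Proof.
rewrite /entropy /kentropy.
transitivity (\big[Rplus/0]_(v <- undup [seq X w | w <- enum 'I_n])
   \big[Rplus/0]_(w < n | X w == v) (- (p w * ln (prob p X v)))).
  by apply: eq_bigr => v _; rewrite Rsum_opp -big_distrl.
rewrite (exchange_big_dep xpredT) //=; apply: eq_bigr => w _.
have Xw : X w \in undup [seq X w | w <- enum 'I_n].
  by rewrite mem_undup map_f // mem_enum.
rewrite (big_rem _ Xw) /= eqxx big1_seq => [|v /andP[/eqP <-]]; last first.
  by rewrite mem_rem_uniq ?undup_uniq // !inE eqxx.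
rewrite Rplus_0_r; congr (- (_ * ln _)).
by apply: eq_bigl => w'; rewrite eq_sym.
Qed.

(** Only kernels matter, so values can be coded injectively by naturals and sample points
    renumbered. Later constructions may thus use products, options and sequences. *)
Lemma is_entropicP (M : finType) (f : {set M} -> R) :
  is_entropic f <->
  exists (W : finType) (p : W -> R) (T : countType) (xi : M -> W -> T),
    (forall w, 0 <= p w) /\ \big[Rplus/0]_w p w = 1 /\
    (forall A, f A = kentropy p (agree xi A)).
Proof.
split.
  move=> [n [p [xi [p0 [p1 fE]]]]]; exists 'I_n, p, nat, xi; split=> //.
  split=> // A; rewrite fE entropyE; apply: eq_kentropy => w w'.
  exact: joint_eqE.
move=> [W [p [T [xi [p0 [p1 fE]]]]]].
have bW (D : {pred W}) : {on D, bijective (@enum_val W W)}.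
  exact: onW_bij (@enum_val_bij W).
exists #|W|, (p \o enum_val), (fun i w => pickle (xi i (enum_val w))).
split=> [w|]; first exact: p0.
split; first by rewrite -p1 [RHS](reindex _ (bW _)).
move=> A; rewrite fE entropyE /kentropy [LHS](reindex _ (bW _)) /=.
apply: eq_bigr => w _; congr (- (_ * ln _)); rewrite [LHS](reindex _ (bW _)) /=.
apply: eq_bigl => w'; rewrite joint_eqE.
apply/agreeP/agreeP => E i iA; first by rewrite E.
exact: (pcan_inj pickleK) (E i iA).
Qed.

Lemma entropic_ext (M : finType) (f g : {set M} -> R) :
  f =1 g -> is_entropic f -> is_entropic g.
Proof.
by move=> fg [n [p [xi [p0 [p1 fE]]]]]; exists n, p, xi; do 2!split=> //; move=> A; rewrite -fg.
Qed.

Lemma kentropyT (W : finType) (p : W -> R) (e : rel W) :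
  \big[Rplus/0]_w p w = 1 -> (forall w w', e w w') -> kentropy p e = 0.
Proof.
move=> p1 eT; apply: big1 => w _.
by rewrite (eq_bigl predT) => [|w']; rewrite ?eT // p1 ln_1; lra.
Qed.

Lemma entropic0 (M : finType) : is_entropic (fun _ : {set M} => 0).
Proof.
apply/is_entropicP; exists unit, (fun _ => 1), unit, (fun _ _ => tt).
have s1 : \big[Rplus/0]_(w : unit) 1 = 1.
  by rewrite (bigD1 tt) //= big1 => [|[]//]; lra.
split=> [w|]; first lra; split=> // A; rewrite kentropyT // => w w'.
exact/agreeP.
Qed.

(** Two independent systems side by side: the kernel class of a pair is a product of classes, and
    the logarithm turns its weight into a sum. *)
Lemma entropicD (M : finType) (f g : {set M} -> R) :
  is_entropic f -> is_entropic g -> is_entropic (fun A => f A + g A).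
Proof.
move=> /is_entropicP[W [p [T [xi [p0 [p1 fE]]]]]].
move=> /is_entropicP[V [q [U [eta [q0 [q1 gE]]]]]].
apply/is_entropicP; exists (W * V)%type, (fun w => p w.1 * q w.2).
exists (T * U)%type, (fun i w => (xi i w.1, eta i w.2)).
split=> [w|]; first exact: Rmult_le_pos.
have pq1 : \big[Rplus/0]_(w : W * V) (p w.1 * q w.2) = 1.
  rewrite -(pair_big predT predT (fun a b => p a * q b)) /=.
  by rewrite -big_distrlr /= p1 q1; lra.
split=> // A; rewrite fE gE {1 2}/kentropy.
set a := fun w => \big[Rplus/0]_(w' | agree xi A w w') p w'.
set b := fun v => \big[Rplus/0]_(v' | agree eta A v v') q v'.
transitivity (\big[Rplus/0]_w \big[Rplus/0]_v
   (- (p w * ln (a w)) * q v + p w * - (q v * ln (b v)))).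
  under [RHS]eq_bigr => w _.
    rewrite big_split /= -(@big_distrr _ _ Rmult) -(@big_distrr _ _ Rmult) /= q1.
    over.
  rewrite big_split /= -(@big_distrl _ _ Rmult) -(@big_distrl _ _ Rmult) /= p1.
  by rewrite /a /b; ring.
rewrite pair_big /=; apply: eq_bigr => -[w v] _ /=.
have -> : \big[Rplus/0]_(w' | agree (fun i w0 => (xi i w0.1, eta i w0.2)) A (w, v) w')
    (p w'.1 * q w'.2) = a w * b v.
  rewrite /a /b big_distrlr /= pair_big /=; apply: eq_bigl => -[w' v'] /=.
  apply/agreeP/andP => [E | [/agreeP E1 /agreeP E2] i iA /=].
    by split; apply/agreeP => i /E[].
  by rewrite E1 // E2.
(* Sample points of weight 0 contribute nothing; for the others [ln_mult] gets positive class
   weights. *)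
have [pw|pw] := Req_dec (p w) 0; first by rewrite pw; ring.
have [qv|qv] := Req_dec (q v) 0; first by rewrite qv; ring.
have aw : p w <= a w by apply: Rsum_ge_term => //; apply/agreeP.
have bv : q v <= b v by apply: Rsum_ge_term => //; apply/agreeP.
have pw0 := p0 w; have qv0 := q0 v.
rewrite ln_mult; [ring | lra | lra].
Qed.

Lemma entropic_mulrn (M : finType) (f : {set M} -> R) (n : nat) :
  is_entropic f -> is_entropic (fun A => INR n * f A).
Proof.
move=> fe; elim: n => [|n IH].
  by apply: entropic_ext (entropic0 M) => A; rewrite /=; ring.
by apply: entropic_ext (entropicD IH fe) => A; rewrite S_INR; ring.
Qed.

Definition bin_entropy (a : R) : R := - (a * ln a) - (1 - a) * ln (1 - a).

(* With probability [a] the variables are revealed, otherwise all of them show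
   one and the same fresh symbol. *)
Lemma entropic_mix (M : finType) (f : {set M} -> R) (a : R) :
  0 < a < 1 -> is_entropic f ->
  is_entropic (fun A => if A == set0 then 0 else a * f A + bin_entropy a).
Proof.
move=> a01 /is_entropicP[W [p [T [xi [p0 [p1 fE]]]]]].
pose q (w : option W) := if w is Some w then a * p w else 1 - a.
pose eta (i : M) (w : option W) := omap (xi i) w.
have sumo (P : pred (option W)) : \big[Rplus/0]_(w | P w) q w =
    (if P None then 1 - a else 0) + a * \big[Rplus/0]_(w | P (Some w)) p w.
  rewrite big_mkcond /= Rsum_option /=; congr (_ + _).
  by rewrite big_distrr /= -big_mkcond.
have q1 : \big[Rplus/0]_w q w = 1 by rewrite sumo /= p1; ring.
apply/is_entropicP; exists (option W), q, (option T), eta.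
split=> [[w|]|]; rewrite /q.
- by apply: Rmult_le_pos; [lra | apply: p0].
- lra.
split=> // A; case: eqP => [->|/eqP/set0Pn[i iA]].
  by rewrite kentropyT // => w w'; apply/agreeP => i; rewrite inE.
rewrite /kentropy Rsum_option /=.
have aN : agree eta A None =1 pred1 None.
  by case=> [w|] /=; apply/agreeP => // /(_ i iA).
have aS w w' : agree eta A (Some w) (Some w') = agree xi A w w'.
  by apply/agreeP/agreeP => E j /E; [case | rewrite /= => ->].
have aSN w : agree eta A (Some w) None = false.
  by apply/negP => /agreeP /(_ i iA).
rewrite (eq_bigl _ _ aN) big_pred1_eq /= /bin_entropy.
under eq_bigr => w _.
  rewrite sumo aSN Rplus_0_l (eq_bigl _ _ (aS w)).
  have -> : - (a * p w * ln (a * \big[Rplus/0]_(w' | agree xi A w w') p w')) =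
      p w * - (a * ln a) +
      a * - (p w * ln (\big[Rplus/0]_(w' | agree xi A w w') p w')).
    have [pw|pw] := Req_dec (p w) 0; first by rewrite pw; ring.
    have aw : p w <= \big[Rplus/0]_(w' | agree xi A w w') p w'.
      by apply: Rsum_ge_term => //; apply/agreeP.
    have pw0 := p0 w; rewrite ln_mult; [ring | lra | lra].
  over.
rewrite big_split /= -(@big_distrl _ _ Rmult) -(@big_distrr _ _ Rmult) /= p1.
by rewrite fE /kentropy; ring.
Qed.

(** The variable at [b] is the tuple of all variables in [phi b]. Restriction, relabelling and
    pullback are special cases. *)
Lemma entropic_cover (M N : finType) (f : {set M} -> R) (phi : N -> {set M}) :
  is_entropic f -> is_entropic (fun B : {set N} => f (\bigcup_(b in B) phi b)).
Proof.
move=> /is_entropicP[W [p [T [xi [p0 [p1 fE]]]]]].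
apply/is_entropicP; exists W, p, (seq T), (fun b w => [seq xi i w | i <- enum (phi b)]).
do 2![split=> //]; move=> B; rewrite fE; apply: eq_kentropy => w w'.
apply/agreeP/agreeP => E.
  move=> b bB; apply/eq_in_map => i; rewrite mem_enum => ib.
  by apply: E; apply/bigcupP; exists b.
move=> i /bigcupP[b bB ib]; have /eq_in_map := E b bB.
by apply; rewrite mem_enum.
Qed.

(** The upper bound, which tends to 0 with [a], comes from [ln x <= x - 1], used at [/ (1 - a)] and
    at [/ sqrt a]. *)
Lemma bin_entropy_le (a : R) : 0 < a < 1 -> 0 <= bin_entropy a <= a + 2 * sqrt a.
Proof.
move=> [a0 a1]; rewrite /bin_entropy.
have ln_le x : 0 < x -> ln x <= x - 1.
  by move=> x0; have := exp_ineq1_le (ln x); rewrite exp_ln //; lra.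
have la : ln a <= a - 1 by apply: ln_le.
have lb : ln (1 - a) <= - a by have := @ln_le (1 - a); lra.
split; first by nra.
have lb' : - ln (1 - a) <= / (1 - a) - 1.
  by rewrite -ln_Rinv; [apply: ln_le; apply: Rinv_0_lt_compat; lra | lra].
have H1 : - ((1 - a) * ln (1 - a)) <= a.
  have -> : - ((1 - a) * ln (1 - a)) = (1 - a) * - ln (1 - a) by ring.
  rewrite [X in _ <= X](_ : a = (1 - a) * (/ (1 - a) - 1)); last by field; lra.
  by apply: Rmult_le_compat_l; lra.
pose s := sqrt a; have s0 : 0 < s by apply: sqrt_lt_R0.
have ss : s * s = a by apply: sqrt_sqrt; lra.
have H2 : - (a * ln a) <= 2 * s.
  have -> : - (a * ln a) = 2 * (a * ln (/ s)).
    by rewrite ln_Rinv // -{2}ss ln_mult //; ring.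
  have : a * ln (/ s) <= a * (/ s).
    apply: Rmult_le_compat_l; first lra.
    by have := @ln_le (/ s) (Rinv_0_lt_compat _ s0); lra.
  have -> : a * / s = s by rewrite -ss; field; lra.
  lra.
rewrite -/s; lra.
Qed.

(** * The almost entropic cone *)

Lemma almost_entropic_ext (M : finType) (f g : {set M} -> R) :
  f =1 g -> is_almost_entropic f -> is_almost_entropic g.
Proof.
by move=> fg fe e e0; have [k [ke kf]] := fe e e0; exists k; split=> // A; rewrite -fg.
Qed.

Lemma almost_entropic0 (M : finType) : is_almost_entropic (fun _ : {set M} => 0).
Proof.
move=> e e0; exists (fun=> 0); split=> [|A]; first exact: entropic0.
by rewrite Rminus_0_r Rabs_R0.
Qed.

Lemma almost_entropicD (M : finType) (f g : {set M} -> R) :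
  is_almost_entropic f -> is_almost_entropic g ->
  is_almost_entropic (fun A => f A + g A).
Proof.
move=> fe ge e e0; have e2 : 0 < e / 2 by lra.
have [f' [f'e ff]] := fe _ e2; have [g' [g'e gg]] := ge _ e2.
exists (fun A => f' A + g' A); split; first exact: entropicD.
move=> A; have := ff A; have := gg A; move: (f A) (g A) (f' A) (g' A) => a b c d.
by rewrite /Rabs; do 3![case: Rcase_abs => ?]; lra.
Qed.

(* [t f] is approximated by revealing, with probability [t / N], [N] independent
   copies of a system close to [f]; the hiding costs only [bin_entropy (t / N)]. *)
Lemma almost_entropicZ (M : finType) (f : {set M} -> R) (t : R) :
  0 < t -> f set0 = 0 -> is_almost_entropic f ->
  is_almost_entropic (fun A => t * f A).
Proof.
move=> t0 f0 fe e e0.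
(* With [a < d], the three bounds give [a < 1] and [bin_entropy a <= a + 2 * sqrt a < e / 4]. *)
pose d := Rmin (1 / 2) (Rmin (e / 8) (e / 16 * (e / 16))).
have d0 : 0 < d by rewrite /d; do 2?[apply: Rmin_pos]; nra.
have [N [Nd N0]] : exists N : nat, t / d < INR N /\ (0 < N)%nat.
  have [N HN] := INR_unbounded (t / d); exists N; split=> //.
  case: N HN => //=; have : 0 < t / d by apply: Rdiv_lt_0_compat.
  lra.
have N0' : 0 < INR N by apply: lt_0_INR; apply/ltP.
pose a := t / INR N.
have aN : a * INR N = t by rewrite /a; field; lra.
have a0 : 0 < a by apply: Rdiv_lt_0_compat.
have ad : a < d.
  apply: (Rmult_lt_reg_r (INR N)) => //; rewrite aN.
  have : t / d * d < INR N * d by apply: Rmult_lt_compat_r.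
  have -> : t / d * d = t by field; lra.
  lra.
have [dh [de d2]] : d <= 1 / 2 /\ d <= e / 8 /\ d <= e / 16 * (e / 16).
  rewrite /d; split; first exact: Rmin_l.
  split; apply: Rle_trans (Rmin_r _ _) _; [exact: Rmin_l | exact: Rmin_r].
have a01 : 0 < a < 1 by lra.
have [h0 hle] := bin_entropy_le a01.
have sa : sqrt a <= e / 16.
  by rewrite -(sqrt_square (e / 16)); [apply: sqrt_le_1; nra | lra].
have et : 0 < e / (2 * t) by apply: Rdiv_lt_0_compat; lra.
have [g [ge gf]] := fe _ et.
exists (fun A => if A == set0 then 0 else a * (INR N * g A) + bin_entropy a).
split; first by apply: entropic_mix => //; apply: entropic_mulrn.
move=> A; case: eqP => [->|_]; first by rewrite f0 Rmult_0_r Rminus_0_r Rabs_R0.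
have -> : t * f A - (a * (INR N * g A) + bin_entropy a) =
  t * (f A - g A) - bin_entropy a by rewrite -aN; ring.
have fgt : Rabs (t * (f A - g A)) < e / 2.
  rewrite Rabs_mult (Rabs_pos_eq t); last lra.
  have -> : e / 2 = t * (e / (2 * t)) by field; lra.
  exact: Rmult_lt_compat_l.
move: fgt; rewrite /Rabs; do 2![case: Rcase_abs => ?]; lra.
Qed.

Lemma almost_entropic_cover (M N : finType) (f : {set M} -> R) (phi : N -> {set M}) :
  is_almost_entropic f -> is_almost_entropic (fun B : {set N} => f (\bigcup_(b in B) phi b)).
Proof.
move=> fe e e0; have [g [ge gf]] := fe e e0.
exists (fun B : {set N} => g (\bigcup_(b in B) phi b)); split=> [|B]; last exact: gf.
exact: entropic_cover.
Qed.

Lemma almost_entropic_preim (M N : finType) (f : {set M} -> R) (h : M -> N) :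
  is_almost_entropic f -> is_almost_entropic (fun B => f (h @^-1: B)).
Proof.
move=> fe; apply: almost_entropic_ext (almost_entropic_cover (fun b => h @^-1: [set b]) fe).
move=> B /=; congr f; apply/setP => x; rewrite inE.
apply/bigcupP/idP => [[b bB]|hx]; first by rewrite !inE => /eqP ->.
by exists (h x) => //; rewrite !inE.
Qed.

Lemma almost_entropic_imset (M N : finType) (f : {set M} -> R) (h : N -> M) :
  is_almost_entropic f -> is_almost_entropic (fun B => f (h @: B)).
Proof.
move=> fe; apply: almost_entropic_ext (almost_entropic_cover (fun b => [set h b]) fe).
move=> B /=; congr f; apply/setP => x.
apply/bigcupP/imsetP => [[b bB]|[b bB ->]]; first by rewrite inE => /eqP ->; exists b.
by exists b => //; rewrite inE.
Qed.

Lemma almost_entropic_setI (M : finType) (f : {set M} -> R) (K : {set M}) :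
  is_almost_entropic f -> is_almost_entropic (fun A => f (A :&: K)).
Proof.
move=> fe; apply: almost_entropic_ext (almost_entropic_cover (fun b => [set b] :&: K) fe).
move=> B /=; congr f; apply/setP => x.
apply/bigcupP/idP => [[b bB]|]; rewrite !inE; first by case/andP=> /eqP -> ->; rewrite bB.
by case/andP=> xB xK; exists x; rewrite // !inE eqxx.
Qed.

(** * Polymatroids and their duals *)

Section Polymatroid.

Variables (M : finType) (f : {set M} -> R).
Hypothesis pf : is_polymatroid f.

Lemma poly0 : f set0 = 0. Proof. by case: pf. Qed.

Lemma poly_ge0 A : 0 <= f A. Proof. by case: pf => _ []. Qed.

Lemma poly_le (A B : {set M}) : A \subset B -> f A <= f B.
Proof. by case: pf => _ [_ [+ _]]; apply. Qed.

Lemma poly_submod (A B : {set M}) : f (A :|: B) + f (A :&: B) <= f A + f B.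
Proof. by case: pf => _ [_ [_]]; apply. Qed.

Lemma poly_subadd (A B : {set M}) : f (A :|: B) <= f A + f B.
Proof. by have := poly_submod A B; have := poly_ge0 (A :&: B); lra. Qed.

(** Diminishing returns: submodularity for [C :|: A] and [B], whose intersection contains [A]. *)
Lemma poly_marginal (A B C : {set M}) :
  A \subset B -> f (C :|: B) - f B <= f (C :|: A) - f A.
Proof.
move=> AB; have := poly_submod (C :|: A) B.
rewrite -setUA (setUidPr AB).
have : f A <= f ((C :|: A) :&: B) by apply: poly_le; rewrite subsetI AB subsetUr.
lra.
Qed.

Lemma poly_le_sum (A : {set M}) : f A <= \big[Rplus/0]_(i in A) f [set i].
Proof.
have [n] := ubnP #|A|; elim: n A => // n IH A.
have [->|/set0Pn[i iA]] := eqVneq A set0.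
  by rewrite big_set0 poly0; lra.
rewrite (cardsD1 i) iA ltnS => /IH {}IH.
rewrite (big_setD1 i) //= -{1}(setD1K iA).
by have := poly_subadd [set i] (A :\ i); lra.
Qed.

Lemma poly_le_card (A : {set M}) :
  (forall i, f [set i] <= 1) -> f A <= INR #|A|.
Proof.
move=> f1; apply: Rle_trans (poly_le_sum A) _.
rewrite -sum1_card; elim/big_ind2: _ => [|x a y b|i _] /=; try lra; last exact: f1.
by rewrite plus_INR; lra.
Qed.

Lemma poly_span (A B : {set M}) :
  (forall a, a \in A -> f (a |: B) <= f B) -> f (A :|: B) = f B.
Proof.
move=> AB; apply: Rle_antisym; last by apply/poly_le/subsetUr.
have [n] := ubnP #|A|; elim: n A AB => // n IH A AB.
have [->|/set0Pn[a aA]] := eqVneq A set0; first by rewrite set0U; lra.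
rewrite (cardsD1 a) aA ltnS => le_n.
have {IH} := IH _ _ le_n.
rewrite -{3}(setD1K aA) -setUA => IH.
have : f (A :\ a :|: B) <= f B by apply: IH => b /setD1P[_]; apply: AB.
have := @poly_marginal B (A :\ a :|: B) [set a] (subsetUr _ _).
by have := AB a aA; lra.
Qed.

(** By diminishing returns, what [y] adds to all the rest of [C :|: Y] it also adds when [Y] is
    built up over [C] one element at a time. *)
Lemma poly_indep_over (C Y : {set M}) :
  (forall y, y \in Y -> f ((C :|: Y) :\ y) + 1 <= f (C :|: Y)) -> [disjoint Y & C] ->
  f C + INR #|Y| <= f (C :|: Y).
Proof.
move=> CY dCY.
suff H n (Z : {set M}) : (#|Z| < n)%nat -> Z \subset Y -> f C + INR #|Z| <= f (C :|: Z).
  exact: (H #|Y|.+1).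
elim: n Z => // n IH Z.
have [->|/set0Pn[z zZ]] := eqVneq Z set0; first by rewrite cards0 setU0 /=; lra.
move=> + ZY; have zY := subsetP ZY z zZ.
rewrite (cardsD1 z) zZ ltnS => /IH {}IH; rewrite add1n S_INR.
have {}IH := IH (subset_trans (subD1set _ _) ZY).
have zC : z \notin C by have /disjointFr -> := dCY.
have sub : C :|: Z :\ z \subset (C :|: Y) :\ z.
  rewrite subUset !subsetD1 zC subsetUl setD11 andbT /=.
  by rewrite (subset_trans (subD1set _ _)) // (subset_trans ZY) // subsetUr.
have := @poly_marginal _ _ [set z] sub.
rewrite setD1K ?inE ?zY ?orbT // setUCA setD1K //.
by have := CY z zY; lra.
Qed.

Lemma poly_scale (c : R) : 0 <= c -> is_polymatroid (fun A => c * f A).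
Proof.
move=> c0; split; first by rewrite poly0; ring.
split=> [A|]; first by apply: Rmult_le_pos => //; exact: poly_ge0.
split=> [A B AB|A B]; first by apply: Rmult_le_compat_l => //; exact: poly_le.
by rewrite -!Rmult_plus_distr_l; apply: Rmult_le_compat_l => //; exact: poly_submod.
Qed.

Lemma poly_comp (N : finType) (Phi : {set N} -> {set M}) :
  Phi set0 = set0 -> {morph Phi : A B / A :|: B} -> {morph Phi : A B / A :&: B} ->
  is_polymatroid (fun A => f (Phi A)).
Proof.
move=> P0 PU PI; split; first by rewrite P0 poly0.
split=> [A|]; first exact: poly_ge0.
split=> [A B /setUidPr <-|A B]; first by rewrite PU; apply/poly_le/subsetUl.
by rewrite PU PI; exact: poly_submod.
Qed.

Lemma poly_contract (D : {set M}) : is_polymatroid (fun A => f (A :|: D) - f D).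
Proof.
split; first by rewrite set0U; ring.
split=> [A|]; first by have := poly_le (subsetUr A D); lra.
split=> [A B AB|A B]; first by have := poly_le (setSU D AB); lra.
have := poly_submod (A :|: D) (B :|: D).
by rewrite -setUUl -setUIl; lra.
Qed.

Lemma poly_dual_polymatroid : is_polymatroid (poly_dual f).
Proof.
(* Going from [A] to [B] costs at most [f (B :\: A)] on the complement, which the singleton ranks of
   [B :\: A] repay. *)
have mon (A B : {set M}) : A \subset B -> poly_dual f A <= poly_dual f B.
  move=> AB; rewrite /poly_dual.
  have -> : \big[Rplus/0]_(i in B) f [set i] =
      \big[Rplus/0]_(i in A) f [set i] + \big[Rplus/0]_(i in B :\: A) f [set i].
    by rewrite (big_setID A) /= (setIidPr AB).
  have := poly_le_sum (B :\: A); have := poly_subadd (~: B) (B :\: A).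
  have -> : ~: B :|: B :\: A = ~: A.
    apply/setP => x; rewrite !inE; have := subsetP AB x.
    by case: (x \in A) => [->|] //; case: (x \in B).
  lra.
have d0 : poly_dual f set0 = 0 by rewrite /poly_dual setC0 big_set0; ring.
split=> //; split=> [A|]; first by rewrite -d0; apply/mon/sub0set.
split=> // A B; rewrite /poly_dual setCU setCI.
have := poly_submod (~: A) (~: B).
have : \big[Rplus/0]_(i in A :|: B) f [set i] + \big[Rplus/0]_(i in A :&: B) f [set i] =
    \big[Rplus/0]_(i in A) f [set i] + \big[Rplus/0]_(i in B) f [set i].
  rewrite (big_setID A) /= setUK setDUl setDv set0U.
  by rewrite [in RHS](big_setID A (A := B)) /= (setIC B); ring.
lra.
Qed.

End Polymatroid.

(** * Ports of rank functions *)

Definition nondummies (P : finType) (Acc : {set {set P}}) : {set P} :=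
  [set i | [exists X : {set P}, (X \notin Acc) && (i |: X \in Acc)]].

(* What remains on the participants of a polymatroid realizing [Acc] in which
   the secret has rank 1 and no participant has larger rank. *)
Record port_rank (P : finType) (r : {set P} -> R) (Acc : {set {set P}}) : Prop :=
  PortRank {
    port_poly : is_polymatroid r;
    port_le1 : forall i, r [set i] <= 1;
    port_crit : forall (A : {set P}) i, A \notin Acc -> i |: A \in Acc -> r A + 1 <= r (i |: A);
    port_span : forall (A B : {set P}) i, A \subset B -> A \notin Acc -> i |: A \in Acc ->
      B \in Acc -> r (i |: B) = r B }.

Section Ports.

Variables (P : finType) (Acc : {set {set P}}).
Hypothesis upA : forall A B : {set P}, A \in Acc -> A \subset B -> B \in Acc.
Let K := nondummies Acc.

Lemma mem_nondummies i X : X \notin Acc -> i |: X \in Acc -> i \in K.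
Proof. by move=> XA iX; rewrite inE; apply/existsP; exists X; rewrite XA. Qed.

(** A minimal qualified subset of [A] consists of nondummies, since removing any member disqualifies
    it. *)
Lemma access_setI A : (A :&: K \in Acc) = (A \in Acc).
Proof.
apply/idP/idP => [|AA]; first by move=> AKA; apply: upA AKA (subsetIl _ _).
have [B /minsetP[BA Bmin] sBA] := @minset_exists _ (fun B : {set P} => B \in Acc) _ AA.
apply: (upA BA); rewrite subsetI sBA; apply/subsetP => i iB.
apply: (@mem_nondummies i (B :\ i)); last by rewrite setD1K.
apply/negP => /Bmin /(_ (subD1set _ _)) E.
by have := iB; rewrite -E !inE eqxx.
Qed.

Lemma access_setU_dummies A : (A :|: ~: K \in Acc) = (A \in Acc).
Proof.
by rewrite -access_setI setIUl [~: K :&: K]setIC setICr setU0 access_setI.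
Qed.

(** Take [B] maximal among the unqualified sets between [A] and [A :|: C]; any element of [A :|: C]
    missing from [B] is critical and lies in [C]. *)
Lemma exists_critical (A C : {set P}) : A \notin Acc -> A :|: C \in Acc ->
  exists j (B : {set P}), [/\ j \in C, B \subset A :|: C, B \notin Acc & j |: B \in Acc].
Proof.
move=> AA ACA; pose Q (B : {set P}) := (B \subset A :|: C) && (B \notin Acc).
have QA : Q A by rewrite /Q subsetUl.
have [B /maxsetP[/andP[BAC BA] Bmax] AB] := maxset_exists QA.
have /subsetPn[j jAC jB] : ~~ (A :|: C \subset B).
  by apply: contra BA => /(upA ACA).
exists j, B; split=> //.
  by move: jAC; rewrite inE => /orP[/(subsetP AB)|//]; rewrite (negbTE jB).
apply: contraR jB => jBA; rewrite -(Bmax (j |: B)) ?setU11 ?subsetUr //.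
by rewrite /Q jBA subUset sub1set jAC BAC.
Qed.

(* Dependence of [C] as seen by [Acc] alone: in the matroid, [X] together with
   [i] and the secret is a circuit whose part outside [C] cannot be shortened. *)
Definition port_dep (C : {set P}) : bool :=
  [exists i in C, exists X : {set P},
    [&& X \notin Acc, i |: X \in Acc, X :|: C :\ i \in Acc &
        [forall y in X :\: C, (C :|: X) :\ y \notin Acc]]].

Definition port_indep (B : {set P}) : bool :=
  [forall C : {set P}, (C \subset B) ==> ~~ port_dep C].

Section Rank.

Variable r : {set P} -> R.
Hypothesis pr : port_rank r Acc.
Let pp := port_poly pr.

(** Bound the rank of [C :|: X] twice. Each element of [X :\: C] is critical on top of the rest,
    giving at least [r C + #|X :\: C|]; and [i] is spanned by the rest, giving at most
    [#|X :\: C| + #|C| - 1]. *)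
Lemma port_dep_rank C : port_dep C -> r C + 1 <= INR #|C|.
Proof.
case/exists_inP => i iC /existsP[X /and4P[XA iXA XCA /forall_inP YA]].
have iX : i \notin X by apply: contra XA => iX; rewrite -(setUidPr _ : i |: X = X) ?sub1set.
have CX : C :|: X \in Acc.
  by apply: upA XCA _; rewrite setUC setSU // subD1set.
have CXE : C :|: X :\: C = C :|: X by rewrite setDE setUIr setUCr setIT.
have := @poly_indep_over _ _ pp C (X :\: C).
rewrite CXE => /(_ _ _) H.
have {}H : r C + INR #|X :\: C| <= r (C :|: X).
  apply: H => [y yX|]; last by rewrite disjoints_subset subsetDr.
  have yCX : y \in C :|: X by move: yX; rewrite !inE => /andP[_ ->]; rewrite orbT.
  rewrite -[X in _ <= r X](setD1K yCX).
  by apply: (port_crit pr); [exact: YA | rewrite setD1K].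
have E : C :|: X = i |: (X :|: C :\ i) by rewrite setUCA setD1K // setUC.
have := port_span pr (subsetUl X (C :\ i)) XA iXA XCA; rewrite -E => rE.
have E2 : X :|: C :\ i = (X :\: C) :|: C :\ i.
  apply/setP => x; rewrite !inE; case: eqP => [->|_]; last by case: (x \in C); rewrite ?orbT.
  by rewrite (negbTE iX) andbF.
have := poly_subadd pp (X :\: C) (C :\ i); rewrite -E2.
have := poly_le_card pp (X :\: C) (port_le1 pr).
have := poly_le_card pp (C :\ i) (port_le1 pr).
rewrite (cardsD1 i C) iC add1n S_INR; lra.
Qed.

(* A witness [(i, X)] with the fewest elements of [X] outside the circuit [C]
   certifies [port_dep C]: a shorter ear could be grown inside [C] otherwise. *)
Lemma circuit_port_dep (C : {set P}) : C \subset K -> r C < INR #|C| ->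
  (forall j, j \in C -> INR #|C :\ j| <= r (C :\ j)) -> port_dep C.
Proof.
move=> CK rC minC.
have /set0Pn[i0 i0C] : C != set0.
  by apply/eqP => C0; move: rC; rewrite C0 (poly0 pp) cards0 /=; lra.
pose Q (u : P * {set P}) := [&& u.1 \in C, u.2 \notin Acc & u.1 |: u.2 \in Acc].
have := subsetP CK i0 i0C; rewrite inE => /existsP[X0 QX0].
have Q0 : Q (i0, X0) by rewrite /Q /= i0C.
case: (arg_minnP (fun u : P * {set P} => #|u.2 :\: C|) Q0) => -[i X].
rewrite /Q /= => /and3P[iC XA iXA] Xmin.
apply/exists_inP; exists i => //; apply/existsP; exists X.
have E : i |: (X :|: C :\ i) = C :|: X by rewrite setUCA setD1K // setUC.
(* Otherwise [i] would raise the rank of [X :|: C :\ i] by at least 1, hence that of [C :\ i] too,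
   making [C] independent. *)
have XCA : X :|: C :\ i \in Acc.
  apply: contraT => XCA.
  have := @port_crit _ _ _ pr _ i XCA; rewrite E => H.
  have {}H : r (X :|: C :\ i) + 1 <= r (C :|: X).
    by apply: H; apply: upA iXA _; rewrite subUset sub1set inE iC subsetUr.
  have := poly_marginal pp [set i] (subsetUr X (C :\ i)); rewrite E setD1K //.
  have := minC i iC; move: rC; rewrite (cardsD1 i C) iC add1n S_INR; lra.
rewrite XA iXA XCA /=; apply/forall_inP => y; rewrite inE => /andP[yC yX].
apply/negP => yA.
(* If the union stays qualified without [y], then [C] completes [X :\ y] and supplies a critical [j]
   in [C] whose set [B] has fewer elements outside [C]. *)
have XyA : X :\ y \notin Acc by apply: contra XA => XyA; apply: upA XyA (subD1set _ _).
have [|j [B [jC BXC BA jBA]]] := @exists_critical (X :\ y) C XyA.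
  apply: upA yA _; apply/subsetP => x; rewrite !inE.
  by case: (x == y) => //=; rewrite orbC.
have := Xmin (j, B); rewrite jC BA jBA /= => /(_ isT).
rewrite leqNgt => /negP; apply.
apply: proper_card; apply/properP; split; last first.
  exists y; first by rewrite !inE yC.
  rewrite !inE yC /=; apply/negP => /(subsetP BXC).
  by rewrite !inE eqxx (negbTE yC).
apply/subsetP => x; rewrite !inE => /andP[xC /(subsetP BXC)].
by rewrite !inE (negbTE xC) orbF => /andP[].
Qed.

(** Delete elements as long as the set remains dependent; what is left is a circuit. *)
Lemma dependent_port_dep (C : {set P}) : C \subset K -> r C < INR #|C| ->
  exists2 C' : {set P}, C' \subset C & port_dep C'.
Proof.
have [n] := ubnP #|C|; elim: n C => // n IH C le_n CK rC.
have [/exists_inP[j jC]|] :=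
  boolP [exists j in C, if Rlt_dec (r (C :\ j)) (INR #|C :\ j|) then true else false].
  case: Rlt_dec => // rCj _.
  have [||C' C'C dC'] := IH _ _ _ rCj; last 1 first.
  - by exists C' => //; apply: subset_trans C'C (subD1set _ _).
  - by move: le_n; rewrite (cardsD1 j) jC.
  - by apply: subset_trans CK; apply: subD1set.
rewrite negb_exists_in => /forall_inP minC.
exists C => //; apply: circuit_port_dep => // j /minC.
by case: Rlt_dec => // H _; lra.
Qed.

Lemma port_indep_rank (B : {set P}) : B \subset K -> port_indep B -> r B = INR #|B|.
Proof.
move=> BK /forall_inP iB; apply: Rle_antisym.
  exact: poly_le_card pp _ (port_le1 pr).
apply: Rnot_lt_le => /(dependent_port_dep BK)[C CB dC].
by have := iB C CB; rewrite dC.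
Qed.

(** An element [a] outside [B] closes a dependent [C] with [C :\ a] inside the independent [B]; so
    [a] adds nothing to [C :\ a], hence nothing to [B]. *)
Lemma port_maxindep_rank (A B : {set P}) : A \subset K ->
  maxset (fun B : {set P} => (B \subset A) && port_indep B) B -> r A = INR #|B|.
Proof.
move=> AK /maxsetP[/andP[BA iB] Bmax].
have BK := subset_trans BA AK.
rewrite -(port_indep_rank BK iB) -[in LHS](setUidPl BA).
apply: (poly_span pp) => a aA.
have [aB|aB] := boolP (a \in B).
  by rewrite (setUidPr _) ?sub1set //; lra.
have /forall_inPn[C CaB /negPn dC] : ~~ port_indep (a |: B).
  apply: contra aB => iaB; rewrite -(Bmax (a |: B)) ?setU11 ?subsetUr //.
  by rewrite iaB subUset sub1set aA BA.
have CB : C :\ a \subset B by rewrite subDset.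
have aC : a \in C.
  apply: contraT => aC; have := forall_inP iB C.
  rewrite dC => /(_ _); apply.
  by apply: subset_trans CB; rewrite subsetD1 subxx.
have iC : port_indep (C :\ a).
  apply/forall_inP => C' C'C; apply: (forall_inP iB).
  exact: subset_trans C'C CB.
have := port_indep_rank (subset_trans CB BK) iC.
have := port_dep_rank dC; rewrite (cardsD1 a C) aC add1n S_INR.
have := poly_marginal pp [set a] CB; rewrite setD1K //; lra.
Qed.

(** Dummies never change whether a set is qualified, so all conditions survive contracting them. *)
Lemma port_rank_contract : port_rank (fun A => r (A :|: ~: K) - r (~: K)) Acc.
Proof.
split=> [|i|A i AA iA|A B i AB AA iA BA].
- exact: poly_contract.
- by have := poly_subadd pp [set i] (~: K); have := port_le1 pr i; lra.
- have := @port_crit _ _ _ pr (A :|: ~: K) i; rewrite setUA !access_setU_dummies.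
  by move=> /(_ AA iA); lra.
congr (_ - _); rewrite -setUA; apply: (port_span pr (setSU (~: K) AB)).
- by rewrite access_setU_dummies.
- by rewrite setUA access_setU_dummies.
- by rewrite access_setU_dummies.
Qed.

End Rank.

(* The rank is the size of a maximal [port_indep] subset, a notion not
   involving [r]: ranks of nondummies are integers determined by the port. *)
Lemma port_rank_unique (A : {set P}) : A \subset K ->
  exists n : nat, forall r, port_rank r Acc -> r A = INR n.
Proof.
move=> AK.
pose Q (B : {set P}) := (B \subset A) && port_indep B.
have i0 : Q set0.
  rewrite /Q sub0set; apply/forall_inP => C; rewrite subset0 => /eqP ->.
  by apply/exists_inP => -[i]; rewrite inE.
have [B Bmax _] := maxset_exists i0.
by exists #|B| => r pr; apply: port_maxindep_rank Bmax.
Qed.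

(** Both [r] and its contraction by the dummies are port ranks, so by uniqueness they agree on
    [A]. *)
Lemma port_rank_split (A : {set P}) r : A \subset K -> port_rank r Acc ->
  r (A :|: ~: K) = r A + r (~: K).
Proof.
move=> AK pr; have [n nE] := port_rank_unique AK.
by have := nE _ pr; have := nE _ (port_rank_contract pr); lra.
Qed.

Lemma nondummies_neq0 : Acc <> set0 -> set0 \notin Acc -> K <> set0.
Proof.
move=> /eqP/set0Pn[A AA] A0 K0.
by move: AA; rewrite -access_setI K0 setI0 (negbTE A0).
Qed.

Lemma port_nondummy r i : port_rank r Acc -> i \in K -> r [set i] = 1.
Proof.
move=> pr; rewrite inE => /existsP[X /andP[XA iX]].
have := port_crit pr XA iX; have := poly_subadd (port_poly pr) [set i] X.
by have := port_le1 pr i; lra.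
Qed.

End Ports.

(** * Duals of access structures and their nondummies *)

Section DualAccess.

Variables (P : finType) (Acc : {set {set P}}).

Lemma dual_accessK : dual_access (dual_access Acc) = Acc.
Proof. by apply/setP => A; rewrite !inE negbK setCK. Qed.

Lemma dual_access_structure :
  is_access_structure Acc -> is_access_structure (dual_access Acc).
Proof.
move=> [/eqP/set0Pn[A AA] [upA A0]]; split.
  by apply/eqP/set0Pn; exists setT; rewrite inE setCT; apply/negP.
split=> [B C|]; rewrite !inE.
  by move=> + BC; apply: contra => CA; apply: upA CA _; rewrite setCS.
rewrite setC0 => /negP; apply; apply: upA AA (subsetT _).
Qed.

End DualAccess.

(** If [i] is critical for [X], then in the dual it is critical for the complement of [i |: X]. *)
Lemma nondummies_dual (P : finType) (Acc : {set {set P}}) :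
  nondummies (dual_access Acc) = nondummies Acc.
Proof.
suff H (B : {set {set P}}) : nondummies B \subset nondummies (dual_access B).
  by apply/eqP; rewrite eqEsubset H -{2}(dual_accessK Acc) H.
apply/subsetP => i; rewrite !inE => /existsP[X /andP[XB iX]].
apply/existsP; exists (~: (i |: X)); rewrite !inE setCK iX /=.
rewrite setCU setCK.
have -> : ~: [set i] :&: (i |: X) = X; last by [].
apply/setP => x; rewrite !inE; case: eqP => //= ->; apply/esym/negP => iX'.
by move: XB; rewrite -{1}(setUidPr _ : i |: X = X) ?sub1set ?iX.
Qed.

(** * Normalized realizations *)

Record normal_realization (P : finType) (g : {set option P} -> R)
    (Acc : {set {set P}}) : Prop := NormalRealization {
  nr_poly : is_polymatroid g;
  nr_secret : g [set None] = 1;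
  nr_le1 : forall i : P, g [set Some i] <= 1;
  nr_sAdd : forall A, g (sAdd A) = g (Some @: A) + if A \in Acc then 0 else 1 }.

Section SecretSets.

Variable P : finType.

Lemma in_sAdd (A : {set P}) x :
  (x \in sAdd A) = if x is Some i then i \in A else true.
Proof. by case: x => [i|]; rewrite !inE //= mem_imset //; apply: Some_inj. Qed.

Lemma in_Some (A : {set P}) x :
  (x \in Some @: A) = if x is Some i then i \in A else false.
Proof.
case: x => [i|]; first by rewrite mem_imset //; apply: Some_inj.
by apply/imsetP => -[].
Qed.

Lemma option_setE (B : {set option P}) :
  B = if None \in B then sAdd (Some @^-1: B) else Some @: (Some @^-1: B).
Proof.
by case: ifP => BN; apply/setP => -[i|]; rewrite ?in_sAdd ?in_Some ?inE ?BN.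
Qed.

Lemma sAddU1 (A : {set P}) i : [set Some i] :|: sAdd A = sAdd (i |: A).
Proof.
by apply/setP => -[j|]; rewrite !(in_sAdd, inE).
Qed.

Lemma setC_Some (A : {set P}) : ~: (Some @: A) = sAdd (~: A).
Proof. by apply/setP => -[i|]; rewrite !(in_sAdd, in_Some, inE). Qed.

Lemma setC_sAdd (A : {set P}) : ~: sAdd A = Some @: ~: A.
Proof. by rewrite -[A in LHS]setCK -setC_Some setCK. Qed.

Lemma sAddS (A B : {set P}) : A \subset B -> sAdd A \subset sAdd B.
Proof. by move=> AB; rewrite setUS // imsetS. Qed.

End SecretSets.

Section Realization.

Variables (P : finType) (Acc : {set {set P}}).
Hypothesis upA : forall A B : {set P}, A \in Acc -> A \subset B -> B \in Acc.

(** Where [i] is critical, the gain of the secret drops from 1 to 0. Monotonicity with the secret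
    present forces [i] to add at least 1 without it. Conversely, with the secret present [i] adds at
    most [g [set Some i] - 1 <= 0]; this persists in supersets, and qualified ones already span the
    secret. *)
Lemma normal_port g :
  normal_realization g Acc -> port_rank (fun A => g (Some @: A)) Acc.
Proof.
move=> ng; have pg := nr_poly ng; split.
- apply: poly_comp => //; first exact: imset0.
    exact: imsetU.
  by move=> A B; apply: imsetI => x y _ _ [].
- by move=> i; rewrite imset_set1; apply: (nr_le1 ng).
- move=> A i AA iA; have := nr_sAdd ng A; have := nr_sAdd ng (i |: A).
  rewrite iA (negbTE AA).
  have := poly_le pg (sAddS (subsetUr [set i] A)); lra.
- move=> A B i AB AA iA BA; apply: Rle_antisym; last first.
    by apply: (poly_le pg); apply/imsetS/subsetUr.
  have := poly_marginal pg [set Some i] (sAddS AB).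
  have iB : i |: B \in Acc by apply: upA BA (subsetUr _ _).
  rewrite !sAddU1 !(nr_sAdd ng) iB BA iA (negbTE AA).
  have := poly_subadd pg [set Some i] (Some @: A).
  have -> : [set Some i] :|: Some @: A = Some @: (i |: A) by rewrite imsetU1.
  have := nr_le1 ng i; rewrite /=; lra.
Qed.

(** The ranks of sets of nondummies are fixed by [port_rank_unique], and the secret adds an amount
    fixed by [Acc]; so [z] can be chosen before [g]. *)
Lemma normal_rank_unique (B : {set option P}) : B \subset sAdd (nondummies Acc) ->
  exists z : Z, forall g, normal_realization g Acc -> g B = IZR z.
Proof.
move=> BK; pose C := Some @^-1: B.
have CK : C \subset nondummies Acc.
  apply/subsetP => i; rewrite inE => /(subsetP BK).
  by rewrite in_sAdd.
have [n nE] := port_rank_unique upA CK.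
have gE g : normal_realization g Acc -> g (Some @: C) = IZR (Z.of_nat n).
  by move=> ng; rewrite -INR_IZR_INZ; apply: (nE _ (normal_port ng)).
rewrite (option_setE B) -/C; case: ifP => _; last by exists (Z.of_nat n).
exists (Z.of_nat n + if C \in Acc then 0 else 1)%Z => g ng.
by rewrite (nr_sAdd ng) plus_IZR gE //; case: ifP.
Qed.

Lemma almost_ideal_normal : almost_ideal Acc ->
  exists2 g, normal_realization g Acc & is_almost_entropic g.
Proof.
move=> [f [pf [fe [fr [fc _]]]]]; set h := f [set None].
have h0 : 0 < h.
  (* With [h = 0] the two clauses of [realizes] at [set0] would share one equation, making [set0]
     qualified exactly when it is unqualified. *)
  have [//|h0] : 0 < h \/ h = 0 by have := poly_ge0 pf [set None]; rewrite -/h; lra.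
  have [[H1 H2] [H3 H4]] := fr set0; move: H3 H4; rewrite -/h h0 Rplus_0_r => H3 H4.
  case: (boolP (set0 \in Acc)) => AA.
    by have := H4 (H1 AA); rewrite AA.
  by have := H2 (H3 AA); rewrite (negbTE AA).
have hi : 0 < / h by apply: Rinv_0_lt_compat.
exists (fun A => / h * f A); last by apply: almost_entropicZ => //; exact: poly0.
split.
- by apply: poly_scale => //; lra.
- by rewrite -/h; field; lra.
- by move=> i; have := fc i; rewrite /Rdiv Rmult_comm.
move=> A; have [H1 H2] := fr A.
case: (boolP (A \in Acc)) => AA; first by rewrite (proj1 H1 AA); ring.
by rewrite (proj1 H2 AA) -/h; field; lra.
Qed.

Lemma normal_almost_ideal g : is_access_structure Acc ->
  normal_realization g Acc -> is_almost_entropic g -> almost_ideal Acc.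
Proof.
move=> [A0 [_ /negP A1]] ng ge; exists g; split; first exact: nr_poly ng.
split=> //; split.
  move=> A; rewrite (nr_sAdd ng) (nr_secret ng).
  by case: (A \in Acc); split; split=> // ?; lra.
rewrite /complexity_one (nr_secret ng); split.
  by move=> i; have := nr_le1 ng i; lra.
(* Any nondummy has rank exactly 1 and so attains the complexity. *)
have /eqP/set0Pn[i iK] := nondummies_neq0 upA A0 A1.
exists i; have := port_nondummy (normal_port ng) iK; rewrite imset_set1; lra.
Qed.

(** Complementation swaps sets with and without the secret, so in the dual the gain of the secret
    over [A] is 1 minus its gain over [~: A] in [g]. *)
Lemma normal_dual g : setT \in Acc ->
  normal_realization g Acc -> normal_realization (poly_dual g) (dual_access Acc).
Proof.
move=> AT ng; have pg := nr_poly ng.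
have gT : g setT = g (Some @: [set: P]).
  have := nr_sAdd ng setT; rewrite AT Rplus_0_r => <-.
  by congr g; apply/setP => -[i|]; rewrite in_sAdd !inE.
split; first exact: poly_dual_polymatroid.
- rewrite /poly_dual big_set1 (nr_secret ng) gT.
  have -> : ~: [set None] = Some @: [set: P].
    by apply/setP => -[i|]; rewrite in_Some !inE.
  ring.
- move=> i; rewrite /poly_dual big_set1.
  have := nr_le1 ng i; have := poly_le pg (subsetT (~: [set Some i])).
  rewrite /reverse_coercion; lra.
move=> A; unfold poly_dual; rewrite setC_sAdd setC_Some (nr_sAdd ng) inE.
rewrite big_setU1 /=; last by rewrite in_Some.
by rewrite (nr_secret ng); case: (_ \in Acc) => /=; ring.
Qed.

End Realization.

(** * Duality of matroids and of access structures *)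

Lemma matroid_dual_access :
  (forall (M : finType) (f : {set M} -> R),
      is_matroid f -> is_almost_entropic f -> is_almost_entropic (poly_dual f)) ->
  forall (P : finType) (Acc : {set {set P}}),
    is_access_structure Acc -> almost_ideal Acc -> almost_ideal (dual_access Acc).
Proof.
move=> dualM P Acc aAcc /almost_ideal_normal[g0 ng0 ge0].
have [A0 [upA A1]] := aAcc.
(* The dummies become loops; by uniqueness every rank is then an integer, so [g] is a matroid, and
   it still realizes [Acc]. *)
set K := nondummies Acc; pose g (A : {set option P}) := g0 (A :&: sAdd K).
have pg0 := nr_poly ng0.
have pg : is_polymatroid g.
  apply: poly_comp => // [|A B|A B]; first exact: set0I.
    exact: setIUl.
  exact: setIIl.
have ng : normal_realization g Acc.
  split=> // [|i|A]; rewrite /g.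
  - rewrite (setIidPl _) ?(nr_secret ng0) // sub1set in_sAdd //.
  - apply: Rle_trans (nr_le1 ng0 i); apply: (poly_le pg0); exact: subsetIl.
  have -> : sAdd A :&: sAdd K = sAdd (A :&: K).
    by apply/setP => -[i|]; rewrite !(in_sAdd, inE).
  have -> : Some @: A :&: sAdd K = Some @: (A :&: K).
    by apply/setP => -[i|]; rewrite inE !in_Some in_sAdd ?inE.
  by rewrite (nr_sAdd ng0) (access_setI upA).
have gz A : exists z, g A = IZR z.
  have [z zE] := normal_rank_unique upA (subsetIr A (sAdd K)).
  by exists z; apply: zE.
have g01 b : g [set b] <= 1.
  by case: b => [i|]; [apply: (nr_le1 ng) | rewrite (nr_secret ng); lra].
have mg : is_matroid g.
  split=> //; split=> // b; have [z zE] := gz [set b].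
  have := poly_ge0 pg [set b]; have := g01 b; rewrite zE => /le_IZR z1 /le_IZR z0.
  have [->|->] : z = 0%Z \/ z = 1%Z by lia.
    by left.
  by right.
have ge : is_almost_entropic g by apply: almost_entropic_setI.
have aD := dual_access_structure aAcc.
have AT : setT \in Acc.
  by case/eqP/set0Pn: A0 => A AA; apply: upA AA (subsetT _).
have [_ [upD _]] := aD.
exact: (normal_almost_ideal upD aD (normal_dual AT ng) (dualM _ _ mg ge)).
Qed.

Lemma matroid_setI (M : finType) (f : {set M} -> R) (S : {set M}) :
  is_matroid f -> is_matroid (fun A => f (A :&: S)).
Proof.
move=> [pf [fz f1]]; split; [|split].
- apply: poly_comp => // [|A B|A B]; first exact: set0I.
    exact: setIUl.
  exact: setIIl.
- by move=> A; apply: fz.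
move=> i; have [iS|iS] := boolP (i \in S).
  by rewrite (setIidPl _) ?sub1set.
left; rewrite (_ : _ :&: S = set0) ?(poly0 pf) //.
by apply/eqP; rewrite setI_eq0 disjoints1.
Qed.

(** [K] is a separator, so [f] is the direct sum of its parts on [K] and [~: K]; in the dual rank of
    a subset of [K] the part on [~: K] cancels. *)
Lemma poly_dual_split (M : finType) (f : {set M} -> R) (K : {set M}) :
  is_polymatroid f ->
  (forall A : {set M}, A \subset K -> f (A :|: ~: K) = f A + f (~: K)) ->
  forall A, poly_dual f A =
    poly_dual f (A :&: K) + poly_dual (fun B => f (B :&: ~: K)) A.
Proof.
move=> pf sepK.
have fI A : f A = f (A :&: K) + f (A :&: ~: K).
  have AE : A :&: K :|: A :&: ~: K = A by rewrite -setIUr setUCr setIT.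
  have := poly_subadd pf (A :&: K) (A :&: ~: K).
  have := poly_marginal pf (A :&: K) (subsetIr A (~: K)).
  rewrite AE (sepK _ (subsetIr _ _)); lra.
move=> A; rewrite /poly_dual setTI (fI (~: A)) (fI (~: (A :&: K))).
have -> : ~: (A :&: K) :&: K = ~: A :&: K.
  by apply/setP => x; rewrite !inE; case: (x \in K); rewrite ?andbT ?andbF.
have -> : ~: (A :&: K) :&: ~: K = ~: K.
  by apply/setP => x; rewrite !inE; case: (x \in K); rewrite ?andbT ?andbF.
have -> : \big[Rplus/0]_(i in A) f [set i] = \big[Rplus/0]_(i in A :&: K) f [set i]
    + \big[Rplus/0]_(i in A) f ([set i] :&: ~: K).
  rewrite (big_setID K) /=; congr (_ + _).
  rewrite [RHS](big_setID K) /= [X in _ = X + _]big1 ?Rplus_0_l => [|i /setIP[_ iK]].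
    by apply: eq_bigr => i; rewrite inE => /andP[iK _]; rewrite (setIidPl _) // sub1set inE.
  rewrite (_ : _ :&: ~: K = set0) ?(poly0 pf) //.
  by apply/eqP; rewrite setI_eq0 disjoints1 inE negbK.
ring.
Qed.

(** * The port of a matroid at an element *)

Section PortAt.

Variables (M : finType) (f : {set M} -> R) (s : M).
Hypothesis mf : is_matroid f.
Hypothesis ds : poly_dual f [set s] <> 0.

Let pf : is_polymatroid f. Proof. by case: mf. Qed.

(* The participants are all of [M], the participant [Some s] being a loop. *)
Let h (x : M) : option M := if x == s then None else Some x.
Definition port_poly_at (B : {set option M}) : R := f (h @^-1: B).

Definition port_at : {set {set M}} :=
  [set A | if Req_dec_T (f (s |: A :\ s)) (f (A :\ s)) then true else false].

Lemma in_port_at A : reflect (f (s |: A :\ s) = f (A :\ s)) (A \in port_at).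
Proof. by rewrite inE; case: Req_dec_T => H; constructor. Qed.

(** Integrality leaves three cases for [s], and the dual rank is 0 both for a loop and for a
    coloop. *)
Lemma noncoloop : f [set s] = 1 /\ f (~: [set s]) = f setT.
Proof.
case: mf => _ [fz f1].
have [z zE] := fz (~: [set s]); have [w wE] := fz setT.
have := ds; rewrite /poly_dual big_set1.
have := poly_le pf (subsetT (~: [set s])).
have := poly_subadd pf (~: [set s]) [set s]; rewrite setUC setUCr zE wE.
case: (f1 s) => ->; first by lra.
rewrite -plus_IZR => /le_IZR H1 /le_IZR H2 H3; split=> //.
have [->//|wz] : z = w \/ w = (z + 1)%Z by lia.
by case: H3; rewrite wz; ring.
Qed.

Lemma preim_port_Some (A : {set M}) : h @^-1: (Some @: A) = A :\ s.
Proof. by apply/setP => x; rewrite !inE in_Some /h; case: (x == s). Qed.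

Lemma preim_port_sAdd (A : {set M}) : h @^-1: (sAdd A) = s |: A :\ s.
Proof. by apply/setP => x; rewrite inE in_sAdd !inE /h; case: (x == s). Qed.

Lemma preim_port_set1 (x : M) : h @^-1: [set h x] = [set x].
Proof.
apply/setP => y; rewrite !inE /h.
by case: (eqVneq y s) => [->|ys]; case: (eqVneq x s) => [xs|xs] //=; rewrite xs (negbTE ys).
Qed.

Lemma port_at_inj : injective h.
Proof.
by move=> x y hxy; apply/set1P; rewrite -preim_port_set1 inE hxy set11.
Qed.

Lemma port_at_access : is_access_structure port_at.
Proof.
have [fs fT] := noncoloop; split.
  apply/eqP/set0Pn; exists setT; apply/in_port_at.
  by rewrite setTD setUCr fT.
split=> [A B /in_port_at AA AB|/in_port_at].
  apply/in_port_at; apply: Rle_antisym; last by apply/(poly_le pf)/subsetUr.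
  by have := poly_marginal pf [set s] (setSD [set s] AB); lra.
by rewrite set0D setU0 fs (poly0 pf); lra.
Qed.

Lemma port_at_realization : normal_realization port_poly_at port_at.
Proof.
have [fs fT] := noncoloop; have [_ [fz f1]] := mf; split.
- by apply: poly_comp => //; [exact: preimset0 | exact: preimsetU | exact: preimsetI].
- by rewrite /port_poly_at -fs -preim_port_set1 /h eqxx.
- move=> i; rewrite /port_poly_at -imset_set1 preim_port_Some.
  apply: Rle_trans (_ : f [set i] <= 1); first exact: (poly_le pf (subD1set _ _)).
  by case: (f1 i) => ->; lra.
move=> A; rewrite /port_poly_at preim_port_sAdd preim_port_Some.
case: in_port_at => [->|]; first ring.
(* Ranks being integers, [s] adds 0 or 1 and nothing between. *)
have [z zE] := fz (A :\ s); have [w wE] := fz (s |: A :\ s).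
have := poly_subadd pf [set s] (A :\ s); have := poly_le pf (subsetUr [set s] (A :\ s)).
rewrite zE wE fs -plus_IZR => /le_IZR H1 /le_IZR H2 H3.
rewrite (_ : w = (z + 1)%Z) ?plus_IZR //.
have wz : w <> z by move=> wz; apply: H3; rewrite wz.
lia.
Qed.

Lemma port_at_dual (A : {set M}) : poly_dual port_poly_at (h @: A) = poly_dual f A.
Proof.
have hK (B : {set M}) : h @^-1: (h @: B) = B.
  by apply/setP => x; rewrite inE mem_imset //; apply: port_at_inj.
rewrite /poly_dual /port_poly_at preimsetC hK preimsetT; congr (_ + _ - _).
rewrite big_imset /= => [|x y _ _]; last exact: port_at_inj.
by apply: eq_bigr => x _; rewrite preim_port_set1.
Qed.

Definition port_support : {set M} := s |: nondummies port_at.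

(* The rank of the nondummies is the same after contracting the dummies. *)
Lemma port_support_sep (A : {set M}) : A \subset port_support ->
  f (A :|: ~: port_support) = f A + f (~: port_support).
Proof.
have [_ [upA _]] := port_at_access; have nF := port_at_realization.
set K := nondummies port_at.
move=> AK; pose B := A :\ s.
have BK : B \subset K by rewrite subDset.
have DE : ~: K :\ s = ~: port_support.
  by rewrite /port_support setCU setIC setDE.
have BE : B :\ s = B by apply/setDidPl; rewrite disjoints_subset subsetC sub1set !inE eqxx.
have BDE : (B :|: ~: K) :\ s = B :|: ~: port_support by rewrite setDUl BE DE.
have := port_rank_split upA BK (normal_port upA nF).
rewrite /port_poly_at !preim_port_Some -/K BDE BE DE => split_B.
have [sA|sA] := boolP (s \in A); last first.
  by move: split_B; rewrite /B (setDidPl _) // disjoint_sym disjoints1.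
have := nr_sAdd nF B; have := nr_sAdd nF (B :|: ~: K).
rewrite /port_poly_at !preim_port_Some !preim_port_sAdd BDE BE.
by rewrite (access_setU_dummies upA) setUA setD1K //; lra.
Qed.

(** [G] and the dual of [port_poly_at] both realize the dual port, so they agree on the secret and
    the nondummies, which are those of the port itself. *)
Lemma port_support_dual (G : {set option M} -> R) :
  normal_realization G (dual_access port_at) ->
  forall A, G (h @: (A :&: port_support)) = poly_dual f (A :&: port_support).
Proof.
move=> nG A; have aA := port_at_access; have [A0 [upA _]] := aA.
have [_ [upD _]] := dual_access_structure aA.
have AT : setT \in port_at.
  by case/eqP/set0Pn: A0 => C CA; apply: upA CA (subsetT _).
have sub : h @: (A :&: port_support) \subset sAdd (nondummies (dual_access port_at)).
  apply/subsetP => _ /imsetP[x /setIP[_ xS] ->]; rewrite nondummies_dual in_sAdd /h.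
  by move: xS; rewrite in_setU1; case: (x == s).
have [z zE] := normal_rank_unique upD sub.
by rewrite -port_at_dual !zE //; apply: normal_dual port_at_realization.
Qed.

Lemma port_at_dual_almost_entropic : is_almost_entropic f ->
  (almost_ideal port_at -> almost_ideal (dual_access port_at)) ->
  is_almost_entropic (fun A => poly_dual f (A :&: port_support)).
Proof.
move=> fe; have [_ [upA _]] := port_at_access.
have Fe : is_almost_entropic port_poly_at by apply: almost_entropic_preim.
move=> /(_ (normal_almost_ideal upA port_at_access port_at_realization Fe)).
move=> /almost_ideal_normal[G nG Ge].
apply: almost_entropic_ext (port_support_dual nG) _.
exact: (almost_entropic_setI port_support (almost_entropic_imset h Ge)).
Qed.

End PortAt.

Lemma access_dual_matroid :
  (forall (P : finType) (Acc : {set {set P}}),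
      is_access_structure Acc -> almost_ideal Acc -> almost_ideal (dual_access Acc)) ->
  forall (M : finType) (f : {set M} -> R),
    is_matroid f -> is_almost_entropic f -> is_almost_entropic (poly_dual f).
Proof.
move=> dualA M f mf fe.
have [S fS] : exists S : {set M}, forall A, f (A :&: S) = f A.
  by exists setT => A; rewrite setIT.
(* Induction on the size of a set [S] outside which every element is a loop. *)
have [n] := ubnP #|S|; elim: n => // n IH in S f mf fe fS *; rewrite ltnS => Sn.
have pf : is_polymatroid f by case: mf.
have [/existsP[s]|/existsPn d0] :=
  boolP [exists s, if Req_dec_T (poly_dual f [set s]) 0 then false else true].
  case: Req_dec_T => // ds _.
  set K := port_support f s.
  have sepK : forall A : {set M}, A \subset K -> f (A :|: ~: K) = f A + f (~: K).
    exact: port_support_sep.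
  apply: almost_entropic_ext (fun A => esym (poly_dual_split pf sepK A)) _.
  apply: almost_entropicD.
    apply: port_at_dual_almost_entropic => //.
    by apply: dualA; apply: port_at_access.
  apply: (IH (S :\: K)); first exact: matroid_setI.
  - exact: almost_entropic_setI.
  - by move=> A; rewrite -[RHS]fS setDE -[in LHS]setIA -(setIA S) setIid (setIC S) setIA.
  (* The element [s] lies in [K], and also in [S] because its rank is 1; so [S :\: K] is smaller
     than [S]. *)
  apply: leq_trans Sn; apply: proper_card; apply/properP; split; first exact: subsetDl.
  have [fs _] := noncoloop mf ds.
  exists s; last by rewrite !inE eqxx.
  apply: contraT => sS; move: fs; rewrite -fS (_ : _ :&: S = set0) ?(poly0 pf); first lra.
  by apply/eqP; rewrite setI_eq0 disjoints1.
(* All singletons have dual rank 0, so the dual vanishes by subadditivity. *)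
apply: almost_entropic_ext (almost_entropic0 M) => A.
have pd := poly_dual_polymatroid pf.
have := poly_le_sum pd A; have := poly_ge0 pd A.
rewrite big1 => [|i _]; first lra.
by have := d0 i; case: Req_dec_T.
Qed.

Theorem theorem3p6 :
  (forall (P : finType) (Acc : {set {set P}}),
      is_access_structure Acc -> almost_ideal Acc -> almost_ideal (dual_access Acc))
  <->
  (forall (M : finType) (f : {set M} -> R),
      is_matroid f -> is_almost_entropic f -> is_almost_entropic (poly_dual f)).
Proof. by split; [exact: access_dual_matroid | exact: matroid_dual_access]. Qed.
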